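(* Let $C_n=\frac{1}{n+1}\binom{2n}{n}$ denote the $n$-th Catalan number. For every integer $n\ge 0$ the following hold (all infinite series converge). i) $$C_n=2\binom{2n}{n}-\frac12\binom{2(n+1)}{n+1}.$$ ii) $$C_{2n+1}=\sum_{i=0}^{n}\binom{2n}{2i}4^{n-i}C_i,\qquad C_{2n+2}=2\sum_{i=0}^{n}\binom{2n+1}{2i}4^{n-i}C_i.$$ iii) $$C_n=\frac32\sum_{i\ge 0}\frac{1}{4^i}\,\frac{(2n+2i)!}{(i+n)!\,(n+i+2)!}.$$ iv) $$\frac{(n+1)!(n+2)!}{(2n+4)!}=\frac{1}{4^{n+2}}\sum_{j\ge 0}\binom{2j}{j}\frac{1}{4^{j}(n+j+2)},$$ or equivalently $$\frac{4^{n+2}}{C_{n+2}}=\sum_{j\ge 0}\binom{2j}{j}\frac{1}{4^j}\,\frac{(n+2)(n+3)}{n+j+2}.$$ v) $$\frac{1}{4^n}\binom{2n}{n}=1-\frac12\sum_{j=0}^{n-1}\frac{C_j}{4^j}.$$ vi) $$\frac{n!\,n!}{(2n+1)!}=4\sum_{j\ge 0}4^j\,\frac{(n+j)!\,(n+j+2)!}{(2n+2j+4)!},$$ or equivalently $$\frac{4^n}{C_n}=\sum_{j\ge 0}\frac{4^{n+j+1}}{C_{n+j+1}}\,\frac{(2n+1)(n+1)}{(n+j+1)(2n+2j+3)(2n+2j+4)}.$$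
   Context: Empty sums equal $0$. *)

(* Defs.v *)
From mathcomp Require Import all_boot all_order all_algebra.
From mathcomp Require Import all_classical all_reals all_analysis.
Import numFieldNormedType.Exports.

Set Implicit Arguments.
Unset Strict Implicit.
Unset Printing Implicit Defensive.

Import Order.TTheory GRing.Theory Num.Theory.
Local Open Scope ring_scope.

(* The division takes place in R, so this is the literal quotient. *)
Definition catalan (R : realType) (n : nat) : R :=
  'C(2 * n, n)%:R / (n + 1)%:R.

(* Main.v *)
Require Import Defs.
From mathcomp Require Import all_boot all_order all_algebra.
From mathcomp Require Import all_classical all_reals all_analysis.
From mathcomp Require Import ring lra zify.
Import numFieldNormedType.Exports.
Import Order.TTheory GRing.Theory Num.Theory.
Local Open Scope classical_set_scope.
Local Open Scope ring_scope.

(** The central binomial coefficient, normalized as b_n = binom(2n, n) / 4^n,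
    satisfies b_(n+1) = b_n (2n+1)/(2n+2). Since C_n = 4^n b_n / (n+1) and
    (2n)! = 4^n b_n n!^2, the identities other than ii) are statements about b. Parts i) and v) then follow from the recurrence.

    In iii) and vi) the summand is hypergeometric in m = n+j alone, and it
    telescopes:
      b_m / ((m+1)(m+2))        = 2/3 (b_m/(m+1) - b_(m+1)/(m+2)),
      1 / ((2m+1)(2m+3) b_m)    = h_m - h_(m+1)  with  h_m = 1/((2m+1) b_m).
    Both sequences being differenced tend to 0, and the sum is their value at
    m = n ([series_central_ratio_tail], [series_inv_central_ratio_tail]).

    The series S_k = sum_j b_j/(j+k+1) of iv) does not telescope for k > 0, but
    a combination of two consecutive ones does:
      (2k+3) b_j/(j+k+2) - (2k+2) b_j/(j+k+1) = G_j - G_(j+1)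
    with G_j = 2j b_j/(j+k+1), which vanishes at 0 and at infinity. Hence
    (2k+3) S_(k+1) = (2k+2) S_k, and S_0 = 2 because b_j/(j+1) = 2b_j - 2b_(j+1);
    this gives S_k = 1/((k+1) b_(k+1)) ([series_central_ratio]). In terms of
    integrals, S_k is the beta value B(k+1, 1/2).

    Part ii) consists of the two parities of the identity of Touchard
      C_(N+1) = sum_i binom(N, 2i) 2^(N-2i) C_i,
    which comes from expanding (1+X)^(2N) = (2X + (1+X^2))^N. The coefficient
    of X^(N+2s) expresses binom(2N, N+2s) by the numbers binom(2i, i+s), and
    the difference between s = 0 and s = 1 is the identity, since
    C_i = binom(2i, i) - binom(2i, i+1) and
    C_(N+1) = binom(2N, N) - binom(2N, N+2). *)

(** * The identity of Touchard *)

Lemma coef_1DX (R : comNzRingType) (n k : nat) :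
  ((1 + 'X : {poly R}) ^+ n)`_k = 'C(n, k)%:R.
Proof.
elim: n k => [|n IH] k; first by rewrite expr0 coef1; case: k.
rewrite exprS mulrDl mul1r coefD coefXM !IH.
by case: k => [|k] /=; rewrite ?bin0 ?addr0 // binS natrD.
Qed.

Lemma coef_1DX2 (R : comNzRingType) (n k : nat) :
  ((1 + 'X^2 : {poly R}) ^+ n)`_k = (~~ odd k)%:R * 'C(n, k./2)%:R.
Proof.
have -> : (1 + 'X^2 : {poly R}) ^+ n = (1 + 'X) ^+ n \Po 'X^2.
  by rewrite rmorphXn /= comp_polyD comp_polyX comp_polyC.
rewrite coef_comp_poly_Xn // coef_1DX dvdn2 divn2.
by case: odd; rewrite ?mul1r ?mul0r.
Qed.

Lemma sum_even_odd (V : nmodType) (f : nat -> V) (m : nat) :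
  \sum_(0 <= j < 2 * m) f j = \sum_(0 <= i < m) (f (2 * i)%N + f (2 * i).+1).
Proof.
elim: m => [|m IH]; first by rewrite muln0 !big_nil.
by rewrite mulnS !addSn add0n !big_nat_recr //= IH addrA.
Qed.

(** Both sides are the coefficient of X^(N+2s) in (1+X)^(2N) = (2X + (1+X^2))^N.
    On the right the factor (2X)^(N-j) leaves the coefficient of X^(j+2s) in
    (1+X^2)^j, which is nonzero only for even j = 2i. The number m of terms is
    free, because the terms with 2i > N vanish: one m then serves N = 2n and
    N = 2n+1. *)
Lemma binomial_even_expansion (R : comNzRingType) (N s m : nat) :
  (N < 2 * m)%N ->
  'C(2 * N, N + 2 * s)%:R =
  \sum_(0 <= i < m)
    'C(N, 2 * i)%:R * 2 ^+ (N - 2 * i) * 'C(2 * i, i + s)%:R :> R.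
Proof.
move=> ltNm.
pose f j : R := 'C(N, j)%:R * 2 ^+ (N - j) *
  ((~~ odd j)%:R * 'C(j, (j + 2 * s)./2)%:R).
have -> : 'C(2 * N, N + 2 * s)%:R = \sum_(0 <= j < N.+1) f j.
  rewrite -coef_1DX exprM.
  have -> : (1 + 'X : {poly R}) ^+ 2 = 2 *: 'X + (1 + 'X^2).
    by rewrite -mul_polyC rmorph_nat; ring.
  rewrite exprDn coef_sum big_mkord; apply: eq_bigr => -[j /= ltj] _.
  rewrite coefMn exprZn -scalerAl coefZ coefXnM ifF; last by lia.
  have -> : (N + 2 * s - (N - j) = j + 2 * s)%N by lia.
  rewrite coef_1DX2 oddD mul2n odd_double addbF /f mul2n.
  by rewrite -mulr_natl; ring.
have -> : \sum_(0 <= j < N.+1) f j = \sum_(0 <= j < 2 * m) f j.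
  rewrite [RHS](big_cat_nat _ (n := N.+1)) //=.
  rewrite [X in _ = _ + X]big_nat_cond [X in _ = _ + X]big1 ?addr0 //.
  move=> j /andP[/andP[ltNj _] _].
  by rewrite /f bin_small // !mul0r.
rewrite sum_even_odd; apply: eq_bigr => i _.
rewrite /f /= mul2n odd_double /= mul0r mulr0 addr0 mul1r.
by congr (_ * 'C(_, _)%:R); lia.
Qed.

(** This difference form is linear in binomial coefficients, unlike the
    quotient, and so can be summed against [binomial_even_expansion]. *)
Lemma catalan_ballot (R : realType) k :
  catalan R k = 'C(2 * k, k)%:R - 'C(2 * k, k.+1)%:R.
Proof.
have h : k.+1%:R * 'C(2 * k, k.+1)%:R = k%:R * 'C(2 * k, k)%:R :> R.
  by rewrite -!natrM mul_bin_left mul2n -addnn addnK.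
rewrite /catalan addn1; apply: (canLR (mulfK _)); first by rewrite pnatr_eq0.
by rewrite mulrBl -(mulrC k.+1%:R 'C(_, k.+1)%:R) h; ring.
Qed.

(** Two applications of Pascal's rule turn [catalan_ballot] at N+1 into an
    expression in the single row 2N; the two copies of binom(2N, N+1) cancel. *)
Lemma catalanS_binomial (R : realType) N :
  catalan R N.+1 = 'C(2 * N, N)%:R - 'C(2 * N, N.+2)%:R.
Proof.
rewrite catalan_ballot.
have -> : 'C(2 * N.+1, N.+1) = (2 * ('C(2 * N, N.+1) + 'C(2 * N, N)))%N.
  rewrite mulnS add2n binS -(bin_sub (m := N)); last by lia.
  by have -> : ((2 * N).+1 - N = N.+1)%N by [lia|]; rewrite binS; lia.
rewrite natrM mulnS add2n !binS !natrD; ring.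
Qed.

Lemma touchard (R : realType) (N m : nat) : (N < 2 * m)%N ->
  catalan R N.+1 =
  \sum_(0 <= i < m) 'C(N, 2 * i)%:R * 2 ^+ (N - 2 * i) * catalan R i.
Proof.
move=> ltNm; rewrite catalanS_binomial.
have := @binomial_even_expansion R N 0 m ltNm.
have := @binomial_even_expansion R N 1 m ltNm.
rewrite muln0 muln1 addn0 addn2 => -> ->; rewrite -sumrB.
by apply: eq_bigr => i _; rewrite catalan_ballot addn0 addn1 mulrBr.
Qed.

(** * Series whose terms differ by a telescoping part *)

(** Partial sums satisfy V_N = c U_N + g_0 - g_N; this is creative telescoping,
    which transfers a known sum from one parameter to the next. *)
Lemma cvg_series_recurrence (R : realType) (u v g : R ^nat) (c l : R) :
  (forall j, v j = c * u j + (g j - g j.+1)) ->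
  series u @ \oo --> l -> g @ \oo --> 0 -> series v @ \oo --> c * l + g 0%N.
Proof.
move=> vE ul g0.
have -> : series v = fun N => c * series u N + (g 0%N - g N).
  apply/funext => N; rewrite /series /= (eq_bigr _ (fun j _ => vE j)) big_split /=.
  rewrite -mulr_sumr; congr (_ + _); rewrite -opprB -telescope_sumr //.
  by rewrite -sumrN; apply: eq_bigr => j _; rewrite opprB.
apply: cvgD; first exact: cvgMr.
by rewrite -[X in _ --> X]subr0; apply: cvgB => //; apply: cvg_cst.
Qed.

Lemma cvg_series_telescope (R : realType) (v g : R ^nat) :
  (forall j, v j = g j - g j.+1) -> g @ \oo --> 0 -> series v @ \oo --> g 0%N.
Proof.
move=> vE g0.
rewrite -[g 0%N]add0r -(mul0r 0); apply: (@cvg_series_recurrence R (fun=> 0)) => //.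
- by move=> j; rewrite mulr0 add0r.
- by rewrite /series; under eq_fun do rewrite big1 //; apply: cvg_cst.
Qed.

Lemma cvg_shift_l (R : realType) (u : R ^nat) (l : R) n :
  u @ \oo --> l -> (fun j => u (n + j)%N) @ \oo --> l.
Proof.
move=> ul; under eq_fun do rewrite addnC.
by move: ul; rewrite -(cvg_shiftn n).
Qed.

(** The hypotheses make u_j^2 (j+1) nonincreasing, so that u_j <= 1/sqrt(j+1).
    This order of decay is the exact one for b_j and for 1/((2j+1) b_j). *)
Lemma cvg0_sqr_harmonic (R : realType) (u : R ^nat) : (forall j, 0 <= u j) ->
  u 0%N <= 1 -> (forall j, u j.+1 ^+ 2 * j.+2%:R <= u j ^+ 2 * j.+1%:R) ->
  u @ \oo --> 0.
Proof.
move=> u0 u01 uS.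
have ub j : u j ^+ 2 <= j.+1%:R^-1.
  rewrite -[leRHS]mul1r ler_pdivlMr ?ltr0Sn //.
  elim: j => [|j]; last exact/le_trans/uS.
  by rewrite mulr1; have := u0 0%N; nra.
have sq0 : (fun j => u j ^+ 2) @ \oo --> (0 : R).
  apply: (@squeeze_cvgr _ _ _ _ (fun=> 0) harmonic); last exact: cvg_harmonic.
    by near=> j; rewrite sqr_ge0 ub.
  exact: cvg_cst.
rewrite -(@sqrtr0 R) (_ : u = fun j => Num.sqrt (u j ^+ 2)); last first.
  by apply/funext => j; rewrite sqrtr_sqr ger0_norm.
exact: (cvg_comp _ _ sq0 (@sqrt_continuous R 0)).
Unshelve. all: by end_near. Qed.

Lemma cvg_series_scale (R : realType) (u v : R ^nat) (c l : R) :
  (forall j, v j = c * u j) ->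
  series u @ \oo --> l -> series v @ \oo --> c * l.
Proof.
move=> vE ul; rewrite -[c * l]addr0.
apply: (@cvg_series_recurrence R u v (fun=> 0)) => //; last exact: cvg_cst.
by move=> j; rewrite vE subr0 addr0.
Qed.

Lemma cvgn_limnM (R : realType) (u : R ^nat) (a c l : R) :
  u @ \oo --> l -> a = c * l -> cvgn u /\ a = c * limn u.
Proof.
by move=> ul ->; split; [apply/cvg_ex; exists l|rewrite (cvg_lim _ ul)].
Qed.

Lemma cvgn_limn (R : realType) (u : R ^nat) (a l : R) :
  u @ \oo --> l -> a = l -> cvgn u /\ a = limn u.
Proof.
by move=> ul ->; split; [apply/cvg_ex; exists l|rewrite (cvg_lim _ ul)].
Qed.

(** * The normalized central binomial coefficients *)

Definition central_ratio (R : realType) (n : nat) : R := 'C(2 * n, n)%:R / 4 ^+ n.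

Section CentralRatio.
Variable R : realType.
Local Notation b := (central_ratio R).

Lemma fact_double (n : nat) : (2 * n)`!%:R = b n * 4 ^+ n * n`!%:R ^+ 2 :> R.
Proof.
rewrite /central_ratio divfK ?expf_neq0 ?pnatr_eq0 // -natrX -natrM.
rewrite -(bin_fact (m := n)); last by lia.
by have -> : (2 * n - n = n)%N by lia.
Qed.

Lemma central_ratio0 : b 0 = 1.
Proof. by rewrite /central_ratio muln0 bin0 expr0 divr1. Qed.

Lemma central_ratio_gt0 n : 0 < b n.
Proof. by rewrite divr_gt0 ?exprn_gt0 // ltr0n bin_gt0; lia. Qed.

Lemma fact_neq0 n : n`!%:R != 0 :> R.
Proof. by rewrite pnatr_eq0 -lt0n fact_gt0. Qed.

Lemma exp4_neq0 n : 4 ^+ n != 0 :> R.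
Proof. by rewrite expf_neq0 ?pnatr_eq0. Qed.

Lemma central_ratioS n : b n.+1 = b n * (2 * n%:R + 1) / (2 * n%:R + 2).
Proof.
have n0 : 0 <= n%:R :> R by [].
have := fact_double n.+1.
rewrite mulnS add2n !factS !natrM fact_double [4 ^+ n.+1]exprS.
have := fact_neq0 n; have := exp4_neq0 n.
set f := n`!%:R; set e := 4 ^+ n => e0 f0 h.
have D0 : 4 * e * (n.+1%:R * f) ^+ 2 != 0 :> R.
  rewrite mulf_eq0 negb_or mulf_eq0 negb_or sqrf_eq0 mulf_eq0 negb_or.
  by rewrite e0 f0 !pnatr_eq0.
apply: (mulIf D0); rewrite [LHS]mulrA -h -!natr1 natrM.
by field; apply: lt0r_neq0; lra.
Qed.

Lemma catalanE n : catalan R n = 4 ^+ n * b n / (n%:R + 1).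
Proof.
by rewrite /catalan /central_ratio natrD mulrCA divff ?mulr1 ?exp4_neq0.
Qed.

Lemma cvg_central_ratio : b @ \oo --> 0.
Proof.
apply: cvg0_sqr_harmonic => [j||j].
- exact/ltW/central_ratio_gt0.
- by rewrite central_ratio0.
rewrite central_ratioS expr_div_n mulrAC ler_pdivrMr; last first.
  by rewrite exprn_gt0 // ltr_wpDl // mulr_ge0.
have j0 : 0 <= j%:R :> R by [].
set x := b j; rewrite exprMn -mulrA -[leRHS]mulrA ler_wpM2l ?sqr_ge0 //.
by rewrite -[j.+2%:R]natr1 -[j.+1%:R]natr1; nra.
Qed.

Lemma cvg_inv_central_ratio :
  (fun n => ((2 * n%:R + 1) * b n)^-1) @ \oo --> 0.
Proof.
have pos j : 0 < (2 * j%:R + 1) * b j.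
  by rewrite mulr_gt0 ?central_ratio_gt0 // ltr_wpDl // mulr_ge0.
apply: cvg0_sqr_harmonic => [j||j].
- by rewrite invr_ge0 ltW.
- by rewrite central_ratio0 mulr0 add0r mulr1 invr1.
have j0 : 0 <= j%:R :> R by [].
have := pos j; set x := _ * b j => x0.
have -> : (2 * j.+1%:R + 1) * b j.+1 = x * ((2 * j%:R + 3) / (2 * j%:R + 2)).
  by rewrite central_ratioS /x -natr1; field; apply: lt0r_neq0; lra.
rewrite invfM exprMn -mulrA ler_wpM2l ?sqr_ge0 // invf_div expr_div_n mulrAC.
rewrite ler_pdivrMr; last by rewrite exprn_gt0 //; lra.
by rewrite -[j.+2%:R]natr1 -[j.+1%:R]natr1; nra.
Qed.

(** * The sums of the series *)

(** For k = 0 the series telescopes. The step from k to k+1 uses creative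
    telescoping with the certificate G_j = 2j b_j / (j+k+1), divided by 2k+3. *)
Lemma series_central_ratio k :
  series (fun j => b j / (j%:R + k%:R + 1)) @ \oo --> ((k%:R + 1) * b k.+1)^-1.
Proof.
have b0 := cvg_central_ratio.
elim: k => [|k IH].
  have -> : ((0%:R + 1) * b 1)^-1 = 2 * b 0.
    by rewrite central_ratioS central_ratio0 mulr0 !add0r !mul1r mulr1 invrK.
  apply: (@cvg_series_telescope R _ (fun j => 2 * b j)).
    move=> j; have j0 : 0 <= j%:R :> R by [].
    by rewrite central_ratioS; field; rewrite !lt0r_neq0 //; lra.
  by rewrite -(mulr0 2); apply: cvgMr.
have k0 : 0 <= k%:R :> R by [].
pose g j := (2 * j%:R) / ((j%:R + k%:R + 1) * (2 * k%:R + 3)) * b j.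
have g0 : g @ \oo --> (0 : R).
  apply: (@squeeze_cvgr _ _ _ _ (fun=> 0) (fun j => 2 * b j)).
  (* b_j -> 0 suffices for g, since j / (j+k+1) <= 1 and 2k+3 >= 1. *)
  - near=> j; have j0 : 0 <= j%:R :> R by [].
    have bj := central_ratio_gt0 j; apply/andP; split.
      by rewrite mulr_ge0 ?(ltW bj) // divr_ge0 ?mulr_ge0 //; lra.
    rewrite ler_wpM2r ?(ltW bj) // ler_pdivrMr; first by nra.
    by rewrite mulr_gt0 //; lra.
  - exact: cvg_cst.
  - by rewrite -(mulr0 2); apply: cvgMr.
set c := (2 * k%:R + 2) / (2 * k%:R + 3) : R.
suff -> : ((k.+1%:R + 1) * b k.+2)^-1 = c * ((k%:R + 1) * b k.+1)^-1 + g 0%N.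
  apply: cvg_series_recurrence IH g0 => j.
  have j0 : 0 <= j%:R :> R by [].
  rewrite /g /c central_ratioS -!natr1; field.
  by rewrite !lt0r_neq0 //; lra.
rewrite /g /c mulr0 !mul0r addr0 (central_ratioS k.+1) -natr1.
have := central_ratio_gt0 k.+1; set x := b _ => x0.
by field; rewrite !lt0r_neq0 //; lra.
Unshelve. all: by end_near. Qed.

(** The antidifference of the summand is 2/3 b_m/(m+1) at m = n+j. *)
Lemma series_central_ratio_tail n :
  series (fun j => b (n + j) / (((n + j)%:R + 1) * ((n + j)%:R + 2))) @ \oo -->
  2 / 3 * (b n / (n%:R + 1)).
Proof.
pose g m := 2 / 3 * (b m / (m%:R + 1)).
have g0 : g @ \oo --> (0 : R).
  rewrite -(mulr0 (2 / 3)) -[X in _ * X](mulr0 0); apply: cvgMr.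
  apply: cvgM; first exact: cvg_central_ratio.
  by under eq_fun do rewrite natr1; exact: cvg_harmonic.
rewrite -[n in X in _ --> X]addn0 -/(g (n + 0)%N).
apply: (@cvg_series_telescope R _ (fun j => g (n + j)%N)); last exact: cvg_shift_l.
move=> j; rewrite /g addnS central_ratioS -[(n + j).+1%:R]natr1.
have m0 : 0 <= (n + j)%:R :> R by [].
by field; rewrite !lt0r_neq0 //; lra.
Qed.

(** The antidifference of the summand is 1/((2m+1) b_m) at m = n+j, which is the
    m-th Wallis quotient 4^m m!^2 / (2m+1)!. *)
Lemma series_inv_central_ratio_tail n :
  series (fun j => ((2 * (n + j)%:R + 1) * (2 * (n + j)%:R + 3) * b (n + j))^-1)
    @ \oo --> ((2 * n%:R + 1) * b n)^-1.
Proof.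
pose g m := ((2 * m%:R + 1) * b m)^-1.
rewrite -[n in X in _ --> X]addn0 -/(g (n + 0)%N).
apply: (@cvg_series_telescope R _ (fun j => g (n + j)%N)); last first.
  exact/cvg_shift_l/cvg_inv_central_ratio.
move=> j; rewrite /g addnS central_ratioS -[(n + j).+1%:R]natr1.
have m0 : 0 <= (n + j)%:R :> R by [].
have := central_ratio_gt0 (n + j); set x := b _ => x0.
by field; rewrite !lt0r_neq0 //; lra.
Qed.

Lemma central_binomialE n : 'C(2 * n, n)%:R = 4 ^+ n * b n.
Proof. by rewrite mulrC divfK // exp4_neq0. Qed.

(** * The finite identities in terms of central binomial coefficients *)

Lemma catalan_central_binomial n :
  catalan R n = 2 * 'C(2 * n, n)%:R - 2^-1 * 'C(2 * (n + 1), n + 1)%:R.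
Proof.
rewrite addn1 catalanE !central_binomialE central_ratioS exprS.
have n0 : 0 <= n%:R :> R by [].
by field; rewrite !lt0r_neq0 //; lra.
Qed.

Lemma sum_catalan_over_exp4 n :
  b n = 1 - 2^-1 * \sum_(0 <= j < n) catalan R j / 4 ^+ j.
Proof.
elim: n => [|n IH]; first by rewrite big_nil mulr0 subr0 central_ratio0.
rewrite big_nat_recr //= mulrDr opprD addrA -IH central_ratioS catalanE.
have n0 : 0 <= n%:R :> R by [].
by field; rewrite exp4_neq0 !lt0r_neq0 //; lra.
Qed.

End CentralRatio.

Theorem theorem2 (R : realType) (n : nat) :
  (* i *)
  catalan R n = 2 * 'C(2 * n, n)%:R - 2^-1 * 'C(2 * (n + 1), n + 1)%:R
  /\
  (* ii *)
  (catalan R (2 * n + 1) =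
     \sum_(0 <= i < n.+1) 'C(2 * n, 2 * i)%:R * 4 ^+ (n - i) * catalan R i
   /\
   catalan R (2 * n + 2) =
     2 * \sum_(0 <= i < n.+1)
           'C(2 * n + 1, 2 * i)%:R * 4 ^+ (n - i) * catalan R i)
  /\
  (* iii *)
  (cvgn [series (1 / 4 ^+ i * ((2 * n + 2 * i)`!%:R
                   / ((i + n)`!%:R * (n + i + 2)`!%:R)) : R)]_i
   /\
   catalan R n =
     3 / 2 * limn [series (1 / 4 ^+ i * ((2 * n + 2 * i)`!%:R
                   / ((i + n)`!%:R * (n + i + 2)`!%:R)) : R)]_i)
  /\
  (* iv, first form *)
  (cvgn [series ('C(2 * j, j)%:R * (1 / (4 ^+ j * (n + j + 2)%:R)) : R)]_j
   /\
   (n + 1)`!%:R * (n + 2)`!%:R / (2 * n + 4)`!%:R =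
     1 / 4 ^+ (n + 2) *
     limn [series ('C(2 * j, j)%:R * (1 / (4 ^+ j * (n + j + 2)%:R)) : R)]_j)
  /\
  (* iv, second form *)
  (cvgn [series ('C(2 * j, j)%:R * (1 / 4 ^+ j) *
                 ((n + 2)%:R * (n + 3)%:R / (n + j + 2)%:R) : R)]_j
   /\
   4 ^+ (n + 2) / catalan R (n + 2) =
     limn [series ('C(2 * j, j)%:R * (1 / 4 ^+ j) *
                 ((n + 2)%:R * (n + 3)%:R / (n + j + 2)%:R) : R)]_j)
  /\
  (* v *)
  1 / 4 ^+ n * 'C(2 * n, n)%:R =
    1 - 2^-1 * \sum_(0 <= j < n) catalan R j / 4 ^+ j
  /\
  (* vi, first form *)
  (cvgn [series (4 ^+ j * ((n + j)`!%:R * (n + j + 2)`!%:R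
                   / (2 * n + 2 * j + 4)`!%:R) : R)]_j
   /\
   n`!%:R * n`!%:R / (2 * n + 1)`!%:R =
     4 * limn [series (4 ^+ j * ((n + j)`!%:R * (n + j + 2)`!%:R
                   / (2 * n + 2 * j + 4)`!%:R) : R)]_j)
  /\
  (* vi, second form *)
  (cvgn [series (4 ^+ (n + j + 1) / catalan R (n + j + 1) *
                 ((2 * n + 1)%:R * (n + 1)%:R
                   / ((n + j + 1)%:R * (2 * n + 2 * j + 3)%:R
                       * (2 * n + 2 * j + 4)%:R)) : R)]_j
   /\
   4 ^+ n / catalan R n =
     limn [series (4 ^+ (n + j + 1) / catalan R (n + j + 1) *
                 ((2 * n + 1)%:R * (n + 1)%:R
                   / ((n + j + 1)%:R * (2 * n + 2 * j + 3)%:R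
                       * (2 * n + 2 * j + 4)%:R)) : R)]_j).
Proof.
split; first exact: catalan_central_binomial.
split.
  have pow a : (2 ^+ (2 * a) = 4 ^+ a :> R) by rewrite exprM; congr (_ ^+ _); ring.
  split.
    rewrite addn1 (@touchard R (2 * n) n.+1); last by lia.
    by apply: eq_bigr => i _; rewrite -mulnBr pow.
  rewrite addn2 (@touchard R (2 * n).+1 n.+1); last by lia.
  rewrite mulr_sumr; apply: eq_big_nat => i /andP[_ lti].
  have -> : ((2 * n).+1 - 2 * i = (2 * (n - i)).+1)%N by lia.
  by rewrite exprS pow addn1; ring.
have n0 : 0 <= n%:R :> R by [].
have b0 := central_ratio_gt0 R.
split.
  have S := series_central_ratio_tail R n.
  apply: cvgn_limnM (cvg_series_scale _ _ _ (4 ^+ n) _ _ S) _.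
    move=> j; have m0 : 0 <= (n + j)%:R :> R by [].
    rewrite /= -mulnDr fact_double (addnC j n) addn2 !factS !natrM.
    rewrite -[(n + j).+2%:R]natr1 -[(n + j).+1%:R]natr1 exprD.
    by field; rewrite exp4_neq0 fact_neq0 !lt0r_neq0 //; lra.
  by rewrite catalanE; field; rewrite lt0r_neq0 //; lra.
(* With k = n+1 the denominators j+k+1 are the n+j+2 of the statement. *)
have S := series_central_ratio R n.+1.
split.
  apply: cvgn_limnM (cvg_series_scale _ _ _ 1 _ _ S) _.
    move=> j; have j0 : 0 <= j%:R :> R by [].
    rewrite /= central_binomialE -[n.+1%:R]natr1 !natrD.
    by field; rewrite exp4_neq0 !lt0r_neq0 //; lra.
  have -> : (2 * n + 4 = 2 * n.+2)%N by lia.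
  rewrite fact_double addn1 addn2 (factS n.+1) natrM -[n.+2%:R]natr1 -[n.+1%:R]natr1.
  by field; rewrite exp4_neq0 fact_neq0 !lt0r_neq0 //; lra.
split.
  apply: cvgn_limn (cvg_series_scale _ _ _ ((n + 2)%:R * (n + 3)%:R) _ _ S) _.
    move=> j; have j0 : 0 <= j%:R :> R by [].
    rewrite /= central_binomialE -[n.+1%:R]natr1 !natrD.
    by field; rewrite exp4_neq0 !lt0r_neq0 //; lra.
  rewrite catalanE addn2 addn3 -[n.+3%:R]natr1 -[n.+2%:R]natr1 -[n.+1%:R]natr1.
  by field; rewrite exp4_neq0 !lt0r_neq0 //; lra.
split.
  rewrite -sum_catalan_over_exp4 central_binomialE.
  by field; rewrite exp4_neq0.
have T := series_inv_central_ratio_tail R n.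
split.
  apply: cvgn_limnM (cvg_series_scale _ _ _ (4 / 4 ^+ (n + 2)) _ _ T) _.
    move=> j; have m0 : 0 <= (n + j)%:R :> R by [].
    rewrite /=.
    (* Two steps of the recurrence bring b_(m+2), with m = n+j, back to b_m. *)
    have -> : (2 * n + 2 * j + 4 = 2 * (n + j).+2)%N by lia.
    rewrite fact_double addn2 !factS !natrM !central_ratioS.
    rewrite -[(n + j).+2%:R]natr1 -[(n + j).+1%:R]natr1.
    rewrite -[(n + j).+2]addn2 -addnA addnCA !exprD.
    by field; rewrite !exp4_neq0 fact_neq0 !lt0r_neq0 //; lra.
  rewrite addn1 factS natrM fact_double -natr1 natrM exprD.
  by field; rewrite exp4_neq0 fact_neq0 !lt0r_neq0 //; lra.
apply: cvgn_limn (cvg_series_scale _ _ _ ((2 * n + 1)%:R * (n + 1)%:R) _ _ T) _.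
  move=> j; have m0 : 0 <= (n + j)%:R :> R by [].
  rewrite /=.
  have -> : ((2 * n + 2 * j + 3)%:R = 2 * (n + j)%:R + 3 :> R).
    by rewrite !natrD; ring.
  have -> : ((2 * n + 2 * j + 4)%:R = 2 * (n + j)%:R + 4 :> R).
    by rewrite !natrD; ring.
  rewrite addn1 catalanE central_ratioS -[(n + j).+1%:R]natr1.
  by field; rewrite exp4_neq0 !lt0r_neq0 //; lra.
rewrite catalanE natrD natrM natrD.
by field; rewrite exp4_neq0 !lt0r_neq0 //; lra.
Qed.
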